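(* Let $n\ge 1$ and let $K\in\mathcal K_n$ be a convex body in $\mathbb R^n$. For every $x\in\mathfrak{F}_n(K)$ there exists an affine invariant point $p\in\mathfrak{P}_n$ such that $p(K)=x$.
   Context: A convex body in $\mathbb R^n$ is a compact convex subset of $\mathbb R^n$ with nonempty interior. $\mathcal K_n$ denotes the set of all convex bodies of $\mathbb R^n$, equipped with the topology of the Hausdorff distance $d_H(A,B)=\max\{\sup_{b\in B}d(b,A),\ \sup_{a\in A}d(a,B)\}$, where $d$ is the standard Euclidean metric on $\mathbb R^n$. $\operatorname{Aff}(n)$ denotes the group of all nonsingular affine maps of $\mathbb R^n$, i.e. maps $g:\mathbb R^n\to\mathbb R^n$ of the form $gx=v+\sigma x$ with $v\in\mathbb R^n$ fixed and $\sigma:\mathbb R^n\to\mathbb R^n$ an invertible linear map. It acts on $\mathcal K_n$ by $gK=\{gx\mid x\in K\}$. An affine invariant point is a continuous map $p:\mathcal K_n\to\mathbb R^n$ such that $p(gA)=g\,p(A)$ for every $g\in\operatorname{Aff}(n)$ and every $A\in\mathcal K_n$. $\mathfrak{P}_n$ denotes the set of all affine invariant points $p:\mathcal K_n\to\mathbb R^n$. For $K\in\mathcal K_n$, $\mathfrak{F}_n(K)=\{x\in\mathbb R^n\mid gx=x\text{ for every }g\in\operatorname{Aff}(n)\text{ such that }gK=K\}$. *)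

(* Defs.v *)
From HB Require Import structures.
From mathcomp Require Import all_boot all_order all_algebra.
From mathcomp Require Import all_classical all_reals all_analysis.
From mathcomp Require Import ring lra.

Set Implicit Arguments.
Unset Strict Implicit.
Unset Printing Implicit Defensive.

Import Order.TTheory GRing.Theory Num.Theory.
Import numFieldNormedType.Exports.

Local Open Scope classical_set_scope.
Local Open Scope ring_scope.

(* R^n is 'cV[R]_n. Its library topology is that of the sup norm, which is the
   topology of the Euclidean metric; the library's norm is not the Euclidean
   one, hence enorm. *)
Section euclidean_metric.
Context {R : realType} {n : nat}.
Implicit Types (x y z : 'cV[R]_n) (A B : set 'cV[R]_n).

Definition enorm x : R := Num.sqrt (\sum_i x i 0 ^+ 2).

Definition edist x y : R := enorm (x - y).

(* The inf below and the sups in hausdorff_dist are real-valued, with junk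
   value 0 when they do not exist; they exist for nonempty compact sets. *)
Definition dist_to x A : R := inf [set edist x a | a in A].

Definition hausdorff_dist A B : R :=
  Num.max (sup [set dist_to b A | b in B]) (sup [set dist_to a B | a in A]).

Lemma sumsq_ge0 x : 0 <= \sum_i x i 0 ^+ 2.
Proof. by apply: sumr_ge0 => i _; exact: sqr_ge0. Qed.

Lemma enorm_ge0 x : 0 <= enorm x.
Proof. exact: sqrtr_ge0. Qed.

Lemma enorm_sqr x : enorm x ^+ 2 = \sum_i x i 0 ^+ 2.
Proof. by rewrite sqr_sqrtr// sumsq_ge0. Qed.

Lemma enormN x : enorm (- x) = enorm x.
Proof. by congr Num.sqrt; apply: eq_bigr => i _; rewrite mxE sqrrN. Qed.

Lemma enorm0 : enorm 0 = 0.
Proof.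
by rewrite /enorm big1 ?sqrtr0// => i _; rewrite mxE expr0n.
Qed.

Lemma enorm_eq0 x : enorm x = 0 -> x = 0.
Proof.
move=> x0; have /psumr_eq0P : \sum_i x i 0 ^+ 2 = 0.
  by rewrite -enorm_sqr x0 expr0n.
move=> /(_ (fun i _ => sqr_ge0 _)) xi0.
apply/colP => i; rewrite mxE; apply/eqP.
by move: (xi0 i isT) => /eqP; rewrite sqrf_eq0.
Qed.

Lemma enorm_CS x y : \sum_i x i 0 * y i 0 <= enorm x * enorm y.
Proof.
have [x0|x0] := eqVneq (enorm x) 0.
  rewrite x0 mul0r (enorm_eq0 x0) big1// => i _; rewrite mxE mul0r //.
have [y0|y0] := eqVneq (enorm y) 0.
  rewrite y0 mulr0 (enorm_eq0 y0) big1// => i _; rewrite mxE mulr0 //.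
set a := enorm x in x0 *; set b := enorm y in y0 *.
have ab0 : 0 < a * b by rewrite mulr_gt0// lt_neqAle eq_sym ?x0 ?y0 enorm_ge0.
have : 0 <= \sum_i (b * x i 0 - a * y i 0) ^+ 2.
  by apply: sumr_ge0 => i _; exact: sqr_ge0.
rewrite (eq_bigr (fun i => b ^+ 2 * x i 0 ^+ 2 + a ^+ 2 * y i 0 ^+ 2 -
   2 * (a * b) * (x i 0 * y i 0))); last by move=> i _; ring.
rewrite sumrB big_split/= -!mulr_sumr -!enorm_sqr -/a -/b => h.
rewrite -(ler_pM2l ab0); nra.
Qed.

Lemma enormD x y : enorm (x + y) <= enorm x + enorm y.
Proof.
rewrite -(@ler_pXn2r _ 2)// ?nnegrE ?addr_ge0 ?enorm_ge0//.
rewrite sqrrD !enorm_sqr.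
under eq_bigr do rewrite mxE sqrrD.
rewrite !big_split/= -mulr2n.
by rewrite lerD2r lerD2l lerMn2r/= enorm_CS.
Qed.

Lemma edistxx x : edist x x = 0.
Proof. by rewrite /edist subrr enorm0. Qed.

Lemma edist_ge0 x y : 0 <= edist x y.
Proof. exact: enorm_ge0. Qed.

Lemma edist_eq0 x y : edist x y = 0 -> x = y.
Proof. by move=> /enorm_eq0/subr0_eq. Qed.

Lemma edistC x y : edist x y = edist y x.
Proof. by rewrite /edist -enormN opprB. Qed.

Lemma edist_triangle y x z : edist x z <= edist x y + edist y z.
Proof. by rewrite /edist -(subrKA y x (- z)) enormD. Qed.

Lemma continuous_edist x : continuous (edist x).
Proof.
move=> y; rewrite /edist /enorm.
apply: (@continuous_comp _ _ _ (fun y => \sum_i (x - y) i 0 ^+ 2) Num.sqrt);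
  last exact: sqrt_continuous.
apply: continuous_big y => [|i _ y]; first exact: add_continuous.
rewrite (_ : (fun y : 'cV_n => _) = (fun y : 'cV[R]_n => (x i 0 - y i 0) ^+ 2)).
  apply: (@continuous_comp _ _ _ (fun y : 'cV_n => x i 0 - y i 0)
    (fun t => t ^+ 2)); last exact: exprn_continuous.
  by apply: continuousB; [exact: cst_continuous|exact: coord_continuous].
by apply/funext => z; rewrite !mxE.
Qed.

Lemma dist_to_le x A a : A a -> dist_to x A <= edist x a.
Proof.
move=> Aa; apply: ge_inf; last by exists a.
by exists 0 => _ [b _ <-]; exact: edist_ge0.
Qed.

Lemma dist_to_ge0 x A : A !=set0 -> 0 <= dist_to x A.
Proof.
move=> [a Aa]; apply: lb_le_inf; first by exists (edist x a), a.
by move=> _ [b _ <-]; exact: edist_ge0.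
Qed.

Lemma dist_to_attained x A : A !=set0 -> compact A ->
  exists2 a, A a & dist_to x A = edist x a.
Proof.
move=> A0 cA.
have [|a aA amin] := compact_EVT_min A0 cA (f := edist x).
  exact/continuous_subspaceT/continuous_edist.
rewrite inE in aA; exists a => //; apply/eqP; rewrite eq_le dist_to_le//=.
apply: lb_le_inf; first by exists (edist x a), a.
by move=> _ [b Ab <-]; apply: amin; rewrite inE.
Qed.

Lemma dist_to_le_hausdorff A B a : A !=set0 -> compact A -> B !=set0 ->
  A a -> dist_to a B <= hausdorff_dist A B.
Proof.
move=> A0 cA [b Bb] Aa; rewrite le_max; apply/orP; right.
apply: ub_le_sup; last by exists a.
have [|c _ cmax] := compact_EVT_max A0 cA (f := edist b).
  exact/continuous_subspaceT/continuous_edist.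
exists (edist b c) => _ [a' Aa' <-].
by rewrite (le_trans (dist_to_le _ Bb))// edistC cmax// inE.
Qed.

Lemma hausdorff_dist_le A B (e : R) : A !=set0 -> B !=set0 ->
  (forall a, A a -> dist_to a B <= e) -> (forall b, B b -> dist_to b A <= e) ->
  hausdorff_dist A B <= e.
Proof.
move=> [a Aa] [b Bb] AB BA; rewrite ge_max; apply/andP; split; apply: ge_sup.
- by exists (dist_to b A), b.
- by move=> _ [c Bc <-]; exact: BA.
- by exists (dist_to a B), a.
- by move=> _ [c Ac <-]; exact: AB.
Qed.

Lemma hausdorff_distC A B : hausdorff_dist A B = hausdorff_dist B A.
Proof. exact: maxC. Qed.

End euclidean_metric.

Record convex_body (R : realType) (n : nat) := ConvexBody {
  body_set :> set 'cV[R]_n ;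
  body_compact : compact body_set ;
  body_convex : convex_set body_set ;
  body_interior : body_set° !=set0 }.

Section hausdorff_metric.
Context {R : realType} {n : nat}.
Implicit Types A B C : convex_body R n.

Lemma body_nonempty A : (A : set 'cV[R]_n) !=set0.
Proof. by have [x /interior_subset Ax] := body_interior A; exists x. Qed.

Lemma convex_body_eq A B : (A : set 'cV[R]_n) = B -> A = B.
Proof.
case: A B => [A cA vA iA] [B cB vB iB] /= AB; case: _ / AB cB vB iB => cB vB iB.
by congr ConvexBody; exact: Prop_irrelevance.
Qed.

Definition body_dist A B : R := hausdorff_dist A B.

Lemma body_distxx A : body_dist A A = 0.
Proof.
have A0 := body_nonempty A.
have d0 a : body_set A a -> dist_to a A <= 0.
  by move=> Aa; rewrite -(edistxx a) dist_to_le.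
apply/eqP; rewrite eq_le hausdorff_dist_le//=.
have [a Aa] := A0; apply: (le_trans (dist_to_ge0 a A0)).
exact: (dist_to_le_hausdorff A0 (@body_compact _ _ A) A0 Aa).
Qed.

Lemma body_distC A B : body_dist A B = body_dist B A.
Proof. exact: hausdorff_distC. Qed.

Lemma body_dist_near A B a : body_set A a ->
  exists2 b, body_set B b & edist a b <= body_dist A B.
Proof.
move=> Aa.
have [b Bb ab] := dist_to_attained a (body_nonempty B) (@body_compact _ _ B).
exists b => //; rewrite -ab; apply: dist_to_le_hausdorff => //.
- exact: body_nonempty.
- exact: body_compact.
- exact: body_nonempty.
Qed.

Lemma body_dist_eq0 A B : body_dist A B = 0 -> A = B.
Proof.
have sub C D : body_dist C D = 0 -> C `<=` D.
  move=> CD c Cc; have [d Dd] := body_dist_near D Cc; rewrite CD => cd.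
  suff -> : c = d by [].
  by apply: edist_eq0; apply/eqP; rewrite eq_le cd edist_ge0.
move=> AB; apply/convex_body_eq/seteqP; split; first exact: sub.
by apply: sub; rewrite body_distC.
Qed.

Lemma body_dist_triangle B A C :
  body_dist A C <= body_dist A B + body_dist B C.
Proof.
have far A' C' a : body_set A' a -> dist_to a C' <= body_dist A' B + body_dist B C'.
  move=> Aa; have [b Bb ab] := body_dist_near B Aa.
  have [c Cc bc] := body_dist_near C' Bb.
  rewrite (le_trans (dist_to_le _ Cc))// (le_trans (edist_triangle b _ _))//.
  exact: lerD.
apply: hausdorff_dist_le.
- exact: body_nonempty.
- exact: body_nonempty.
- by move=> a; exact: far.
- by move=> c /(far C A); rewrite addrC (body_distC B A) (body_distC C B).
Qed.

HB.instance Definition _ := gen_eqMixin (convex_body R n).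
HB.instance Definition _ := gen_choiceMixin (convex_body R n).
(* This puts on convex_body R n the topology of the Hausdorff distance, the one
   meant by continuous in affine_invariant_points. *)
HB.instance Definition _ := isMetric.Build R (convex_body R n)
  body_distxx body_dist_eq0 body_distC body_dist_triangle.

End hausdorff_metric.

Record affine_map (R : realType) (n : nat) := AffineMap {
  aff_shift : 'cV[R]_n ;
  aff_lin : 'M[R]_n ;
  aff_lin_unit : aff_lin \in unitmx }.

Definition aff_fun (R : realType) (n : nat) (g : affine_map R n)
    (x : 'cV[R]_n) : 'cV[R]_n :=
  aff_shift g + aff_lin g *m x.

Coercion aff_fun : affine_map >-> Funclass.

Section affine_action.
Context {R : realType} {n : nat}.
Implicit Types (g : affine_map R n) (K : convex_body R n).

Lemma mulmx_cV_continuous (S : 'M[R]_n) :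
  continuous (fun x : 'cV[R]_n => S *m x).
Proof.
have -> : (fun x : 'cV[R]_n => S *m x) =
    (fun x : 'cV[R]_n => \sum_j x j 0 *: col j S).
  apply/funext => x; apply/colP => i; rewrite mxE summxE.
  by apply: eq_bigr => j _; rewrite !mxE mulrC.
apply: continuous_big => [|j _ x]; first exact: add_continuous.
have xj : (y : 'cV[R]_n) j 0 @[y --> x] --> x j 0 by exact: coord_continuous.
exact: cvgZ xj (cvg_cst _).
Qed.

Lemma aff_continuous g : continuous g.
Proof.
by move=> x; exact: (cvgD (cvg_cst _) (@mulmx_cV_continuous (aff_lin g) x)).
Qed.

Lemma aff_image_compact g K : compact (g @` K).
Proof.
apply: continuous_compact; last exact: body_compact.
exact/continuous_subspaceT/aff_continuous.
Qed.

Lemma aff_image_convex g K : convex_set (g @` K).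
Proof.
move=> x y l /set_mem[a Ka <-] /set_mem[b Kb <-]; apply/mem_set.
have := @body_convex _ _ K a b l (mem_set Ka) (mem_set Kb).
move=> /set_mem Kab; exists (l%:num *: a + (1 - l%:num) *: b) => //.
have -> : conv l (g a : convex_lmodType 'cV[R]_n) (g b) =
    l%:num *: g a + (1 - l%:num) *: g b by [].
rewrite /aff_fun mulmxDr -!scalemxAr !scalerDr addrACA -scalerDl.
by rewrite [l%:num + _]addrC subrK scale1r.
Qed.

Lemma aff_image_interior g K : (g @` K)° !=set0.
Proof.
have [x Kx] := body_interior K; exists (g x).
pose h (y : 'cV[R]_n) := invmx (aff_lin g) *m (y - aff_shift g).
have gh y : g (h y) = y.
  by rewrite /aff_fun mulmxA mulmxV ?aff_lin_unit// mul1mx addrC subrK.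
have hg y : h (g y) = y.
  by rewrite /h addrC addKr mulmxA mulVmx ?aff_lin_unit// mul1mx.
have hc : continuous h.
  move=> y.
  have ys : (z : 'cV[R]_n) - aff_shift g @[z --> y] --> y - aff_shift g.
    exact: cvgB cvg_id (cvg_cst _).
  exact: cvg_comp ys (@mulmx_cV_continuous (invmx (aff_lin g)) _).
have : nbhs (g x) (h @^-1` K) by apply: hc; rewrite hg.
by apply: filterS => y Ky; exists (h y).
Qed.

Definition aff_act g K : convex_body R n :=
  @ConvexBody R n (g @` K) (@aff_image_compact g K) (@aff_image_convex g K)
    (aff_image_interior g K).

Definition affine_fixed_set K : set 'cV[R]_n :=
  [set x | forall g, aff_act g K = K -> g x = x].

Definition affine_invariant_points : set (convex_body R n -> 'cV[R]_n) :=
  [set p | continuous p /\ forall g K, p (aff_act g K) = g (p K)].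

End affine_action.

(* Main.v *)
From Pilot Require Import Defs.
From mathcomp Require Import all_boot all_order all_algebra.
From mathcomp Require Import all_classical all_reals all_analysis.
From mathcomp Require Import ring lra.

Set Implicit Arguments.
Unset Strict Implicit.
Unset Printing Implicit Defensive.

Import Order.TTheory GRing.Theory Num.Theory.
Import numFieldNormedType.Exports.
(* Imported last, so that edist is the Euclidean distance and not the extended
   one. *)
Import Pilot.Defs.

Local Open Scope classical_set_scope.
Local Open Scope ring_scope.

(** Why the theorem holds. The point [p A] is the minimizer of a strictly convex
    function [y |-> F A y] attached to [A] in an affinely invariant way,
      [F A y = sup_g (|g y - x|^2 - Psi (g A))],
    where [g] ranges over all nonsingular affine maps ([score], [value],
    [center]). Replacing [g] by [g h] in the supremum gives
    [F (h A) (h y) = F A y], so the minimizer is equivariant (lemmas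
    [value_act] and [center_act]). No averaging over a group is involved: the
    supremum plays the part of an invariant integral, because a supremum of
    convex functions is convex.

    The penalty [Psi] ([majorant]) is a continuous function on convex bodies
    with [Psi K = 0] and [Psi (g K) >= |g x - x|^2]. Hence [F K x <= 0], while
    the identity map shows that [F K y >= |y - x|^2], and the minimizer for [K]
    is [x] (lemma [centerK]). Only the construction of [Psi] uses that [x] is
    fixed by the symmetries of [K]: by compactness, for every [e > 0] there is
    an [N >= 1] such that [|g x - x|^2 <= e + N * T (g K)] for all [g], where [T]
    ([discrepancy]) measures how far a body is from [K], and [Psi] is the
    infimum of the functions [e + N * T] over all such pairs.

    What makes the supremum behave like a maximum over a compact set is that
    the action is proper (lemma [discrepancy_proper]): if the bodies [A_i] tend
    to a convex body and [T (g_i A_i)] stays bounded, then the maps [g_i]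
    accumulate at a nonsingular map. For this, [T] contains the cube of the
    Hausdorff distance to [K], which outgrows the squared displacements, and
    the inverse of the minimal width, which blows up when bodies flatten.
    Properness shows that the supremum is attained, whence strict convexity and
    uniqueness of the minimizer (lemma [value_min_unique]), and that minimizers
    exist and depend continuously on [A] (lemma [minimizers_cvg]). All limits
    are taken along ultrafilters, so that no subsequences are needed. *)

(** * Euclidean estimates *)

Section euclidean_estimates.
Context {R : realType} {n : nat}.
Implicit Types (x y z u : 'cV[R]_n) (M : 'M[R]_n).

Lemma enormZ (c : R) x : enorm (c *: x) = `|c| * enorm x.
Proof.
rewrite /enorm; under eq_bigr do rewrite mxE exprMn.
by rewrite -mulr_sumr sqrtrM ?sqr_ge0// sqrtr_sqr.
Qed.

Lemma enormB x y : enorm (x - y) <= enorm x + enorm y.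
Proof. by rewrite -(enormN y) enormD. Qed.

Lemma coord_le_enorm x i : `|x i 0| <= enorm x.
Proof.
rewrite -sqrtr_sqr ler_wsqrtr// (bigD1 i)//= lerDl.
by apply: sumr_ge0 => j _; exact: sqr_ge0.
Qed.

Lemma enorm_sum (I : Type) (r : seq I) (f : I -> 'cV[R]_n) :
  enorm (\sum_(i <- r) f i) <= \sum_(i <- r) enorm (f i).
Proof.
elim/big_rec2 : _ => [|i a b _ ab]; first by rewrite enorm0.
by rewrite (le_trans (enormD _ _))// lerD2l.
Qed.

Lemma enorm_delta (j : 'I_n) : enorm (delta_mx j 0 : 'cV[R]_n) = 1.
Proof.
rewrite /enorm (bigD1 j)//= big1 => [|i ij].
  by rewrite mxE !eqxx expr1n addr0 sqrtr1.
by rewrite mxE (negPf ij) expr0n.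
Qed.

(** The parallelogram law; its last term is what makes squared distances strictly
    convex. *)
Lemma edist_midpoint x y z : edist (2^-1 *: (y + z)) x ^+ 2 =
  2^-1 * edist y x ^+ 2 + 2^-1 * edist z x ^+ 2 - 4^-1 * edist y z ^+ 2.
Proof.
rewrite /edist !enorm_sqr !mulr_sumr -big_split/= -sumrB.
by apply: eq_bigr => i _; rewrite !mxE; field.
Qed.

(** This bounds the operator norm (lemma [enorm_mulmx]), and its terms are the
    lengths of the images of the basis vectors, which can be estimated from the
    action of a map on a body. *)
Definition col_norm M : R := \sum_j enorm (col j M).

Lemma col_norm_ge0 M : 0 <= col_norm M.
Proof. by apply: sumr_ge0 => j _; exact: enorm_ge0. Qed.

Lemma enorm_mulmx M z : enorm (M *m z) <= col_norm M * enorm z.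
Proof.
have -> : M *m z = \sum_j z j 0 *: col j M.
  apply/colP => i; rewrite mxE summxE.
  by apply: eq_bigr => j _; rewrite !mxE mulrC.
rewrite (le_trans (enorm_sum _ _))// /col_norm mulr_suml.
apply: ler_sum => j _; rewrite enormZ mulrC ler_wpM2l ?enorm_ge0//.
exact: coord_le_enorm.
Qed.

Definition dot u z : R := (u^T *m z) 0 0.

Lemma dot_le u z : dot u z <= enorm u * enorm z.
Proof.
rewrite /dot mxE; under eq_bigr do rewrite mxE.
exact: enorm_CS.
Qed.

Lemma dotB u y z : dot u (y - z) = dot u y - dot u z.
Proof. by rewrite /dot mulmxBr !mxE. Qed.

Lemma dot_mulmx u M z : dot u (M *m z) = dot (M^T *m u) z.
Proof. by rewrite /dot trmx_mul trmxK mulmxA. Qed.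

Lemma dotuu u : dot u u = enorm u ^+ 2.
Proof.
by rewrite /dot mxE enorm_sqr; apply: eq_bigr => i _; rewrite mxE expr2.
Qed.

End euclidean_estimates.

(** * Limits of matrices and limits along ultrafilters *)

Section convergence.
Context {R : realType}.

Lemma cvg_mx (m n : nat) (I : Type) (F : set_system I) {FF : Filter F}
    (f : I -> 'M[R]_(m, n)) (L : 'M[R]_(m, n)) :
  (forall i j, f t i j @[t --> F] --> L i j) -> f t @[t --> F] --> L.
Proof.
move=> fL A [P nP sPA].
have : \forall t \near F, forall i j, P i j (f t i j).
  by apply: filter_forall => i; apply: filter_forall => j; exact: fL.
by apply: filterS => t ?; exact: sPA.
Qed.

Lemma cvg_coord (m n : nat) (I : Type) (F : set_system I) {FF : Filter F}
    (f : I -> 'M[R]_(m, n)) (L : 'M[R]_(m, n)) i j :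
  f t @[t --> F] --> L -> f t i j @[t --> F] --> L i j.
Proof. by move=> fL; exact: cvg_comp fL (@coord_continuous _ _ _ i j _). Qed.

Lemma cvg_mulmx (m n p : nat) (I : Type) (F : set_system I) {FF : Filter F}
    (f : I -> 'M[R]_(m, n)) (g : I -> 'M[R]_(n, p))
    (a : 'M[R]_(m, n)) (b : 'M[R]_(n, p)) :
  f t @[t --> F] --> a -> g t @[t --> F] --> b ->
  f t *m g t @[t --> F] --> a *m b.
Proof.
move=> fa gb; apply: cvg_mx => i j; rewrite mxE.
under eq_fun do rewrite mxE.
apply: cvg_big => [|k _]; first exact: add_continuous.
by apply: cvgM; exact: cvg_coord.
Qed.

Lemma cvg_edist (n : nat) (I : Type) (F : set_system I) {FF : Filter F}
    (f : I -> 'cV[R]_n) (x y : 'cV[R]_n) :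
  f t @[t --> F] --> x -> edist (f t) y @[t --> F] --> edist x y.
Proof.
move=> fx; under eq_fun do rewrite edistC.
by rewrite edistC; exact: cvg_comp fx (@continuous_edist _ _ y _).
Qed.

Lemma cvg_col_norm0 (n : nat) (I : Type) (F : set_system I) {FF : Filter F}
    (f : I -> 'M[R]_n) (L : 'M[R]_n) :
  f t @[t --> F] --> L -> col_norm (f t - L) @[t --> F] --> 0.
Proof.
move=> fL; rewrite -(_ : \sum_(j < n) 0 = 0); last by rewrite big1.
apply: cvg_big => [|j _]; first exact: add_continuous.
rewrite -(edistxx (col j L)).
under eq_fun do rewrite linearB.
apply: cvg_edist; apply: cvg_mx => i k; rewrite mxE.
under eq_fun do rewrite mxE.
exact: cvg_coord.
Qed.

Lemma cvg_le_near (I : Type) (F : set_system I) {FF : ProperFilter F}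
    (f g : I -> R) (a b : R) :
  f t @[t --> F] --> a -> g t @[t --> F] --> b ->
  (\forall t \near F, f t <= g t) -> a <= b.
Proof.
move=> fa gb fg; rewrite -subr_ge0.
apply: (@closed_cvg _ _ F _ (g \- f) (fun s => 0 <= s)).
- exact: closed_ge.
- by apply: filterS fg => t; rewrite subr_ge0.
- exact: cvgB.
Qed.

End convergence.

Section ultrafilters.
Context {R : realType}.

Lemma ultra_fmap (I J : Type) (U : set_system I) (f : I -> J) :
  UltraFilter U -> UltraFilter (f @ U).
Proof.
move=> UU; split; first exact: fmap_proper_filter.
move=> G GG UG; apply/seteqP; split => // A GA.
have [//|UfA] := in_ultra_setVsetC (f @^-1` A) UU.
have /filter_ex[y []//] : G (A `&` ~` A) by apply: filterI => //; exact: UG.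
Qed.

(** The Bolzano-Weierstrass theorem, without passing to a subsequence. *)
Lemma ultra_bounded_cvg (m n : nat) (I : Type) (U : set_system I)
    {UU : UltraFilter U} (f : I -> 'M[R]_(m, n)) (c : R) :
  (\forall t \near U, forall i j, `|f t i j| <= c) ->
  exists L : 'M[R]_(m, n), f t @[t --> U] --> L.
Proof.
move=> fc.
have h i j : exists l : R, f t i j @[t --> U] --> l.
  have := @segment_compact R (- c) c; rewrite compact_ultra.
  move=> /(_ _ (ultra_fmap (fun t => f t i j) UU))[].
    by apply: filterS fc => t /(_ i j); rewrite /= in_itv/= ler_norml.
  by move=> l [_ fl]; exists l.
exists (\matrix_(i, j) projT1 (cid (h i j))).
by apply: cvg_mx => i j; rewrite mxE; exact: (projT2 (cid (h i j))).
Qed.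

(** The superlevel sets of [f] form a filter base, so an ultrafilter containing
    them behaves like a maximizing sequence, even if [f] is unbounded. *)
Lemma ultra_maximizing (T : Type) (t0 : T) (f : T -> R) :
  exists U : set_system T, UltraFilter U /\
    forall s, \forall t \near U, f s <= f t.
Proof.
pose F : set_system T := filter_from setT (fun s => [set t | f s <= f t]).
have FF : ProperFilter F.
  apply: filter_from_proper => [|s _]; last by exists s => /=.
  apply: filter_from_filter => [|s s' _ _]; first by exists t0.
  have [ss'|s's] := leP (f s) (f s').
    by exists s' => // t /= s't; split => //=; exact: le_trans s't.
  by exists s => // t /= st; split => //=; exact/ltW/(lt_le_trans s's).
have [U [UU FU]] := ultraFilterLemma FF.
by exists U; split => // s; apply: FU; exists s.
Qed.

(** If [W] were not in [F], then the complement of [W] could be added to [F]; so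
    continuity may be tested on ultrafilters. *)
Lemma ultra_ext (T : Type) (F : set_system T) {FF : Filter F} (W : set T) :
  (forall U : set_system T, UltraFilter U -> F `<=` U -> U W) -> F W.
Proof.
move=> FW; apply: contrapT => nFW.
have GG : ProperFilter (within (~` W) F).
  apply: Build_ProperFilter => W0; apply: nFW.
  apply: filterS (W0 : F [set t | ~ W t -> set0 t]) => t nWt.
  by apply: contrapT => /nWt.
have [U [UU GU]] := ultraFilterLemma GG.
have UW : U W.
  by apply: FW => // A FA; apply: GU; apply: filterS FA => t At _.
have UnW : U (~` W) by apply: GU; exact: withinT.
by have /filter_ex[t []] : U (W `&` ~` W) by exact: filterI.
Qed.

End ultrafilters.

(** * Convex bodies and affine maps *)

Section bodies.
Context {R : realType} {n : nat}.
Implicit Types (A B C : convex_body R n) (u v x y : 'cV[R]_n).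

Lemma body_dist_le A B (e : R) :
  (forall a, body_set A a -> exists2 b, body_set B b & edist a b <= e) ->
  (forall b, body_set B b -> exists2 a, body_set A a & edist b a <= e) ->
  body_dist A B <= e.
Proof.
move=> AB BA; apply: hausdorff_dist_le; do ?exact: body_nonempty.
- by move=> a /AB[b Bb]; apply: le_trans; exact: dist_to_le.
- by move=> b /BA[a Aa]; apply: le_trans; exact: dist_to_le.
Qed.

Lemma body_dist_ge0 A B : 0 <= body_dist A B.
Proof.
have [a Aa] := body_nonempty A.
by have [b _] := body_dist_near B Aa; apply: le_trans; exact: edist_ge0.
Qed.

Lemma cvg_bodyP (I : Type) (F : set_system I) {FF : Filter F}
    (f : I -> convex_body R n) A :
  f t @[t --> F] --> A <-> body_dist A (f t) @[t --> F] --> 0.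
Proof.
split=> [/metricType_numDomainType.cvgrPdist_lt fA|/cvgrPdist_lt fA].
  apply/cvgrPdist_lt => e e0; apply: filterS (fA e e0) => t.
  by rewrite sub0r normrN ger0_norm// body_dist_ge0.
apply/metricType_numDomainType.cvgrPdist_lt => e e0.
apply: filterS (fA e e0) => t.
by rewrite sub0r normrN ger0_norm// body_dist_ge0.
Qed.

Lemma cvg_body_dist0 A : body_dist A B @[B --> A] --> 0.
Proof. by apply/(@cvg_bodyP _ (nbhs A)); exact: cvg_id. Qed.

Lemma body_bounded A :
  exists2 rho : R, 0 <= rho & forall a, body_set A a -> enorm a <= rho.
Proof.
have [|c _ cmax] := compact_EVT_max (body_nonempty A) (@body_compact _ _ A)
    (f := edist 0).
  exact/continuous_subspaceT/continuous_edist.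
exists (edist 0 c) => [|a Aa]; first exact: edist_ge0.
by move: (cmax a); rewrite inE => /(_ Aa); rewrite {1}/edist sub0r enormN.
Qed.

Lemma body_ball A : exists a, exists2 r : R,
  0 < r & forall u, enorm u <= r -> body_set A (a + u).
Proof.
have [a /nbhs_ballP[r /= r0 rA]] := body_interior A.
exists a, (r / 2) => [|u ur]; first by rewrite divr_gt0.
apply: rA; split=> // i j; rewrite /ball/= ord1 mxE opprD addNKr normrN.
by rewrite (le_lt_trans (coord_le_enorm u i))// (le_lt_trans ur)//; lra.
Qed.

End bodies.

Section affine_maps.
Context {R : realType} {n : nat}.
Implicit Types (g h : affine_map R n) (A B : convex_body R n) (x y : 'cV[R]_n).

Definition aff_id : affine_map R n := AffineMap 0 (unitmx1 _ _).

Lemma aff_idE x : aff_id x = x.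
Proof. by rewrite /aff_fun/= mul1mx add0r. Qed.

Lemma aff_comp_unit g h : aff_lin g *m aff_lin h \in unitmx.
Proof. by rewrite unitmx_mul !aff_lin_unit. Qed.

Definition aff_comp g h : affine_map R n :=
  AffineMap (g (aff_shift h)) (aff_comp_unit g h).

Lemma aff_compE g h x : aff_comp g h x = g (h x).
Proof. by rewrite /aff_fun/= mulmxDr mulmxA addrA. Qed.

Lemma aff_inv_unit g : invmx (aff_lin g) \in unitmx.
Proof. by rewrite unitmx_inv aff_lin_unit. Qed.

Definition aff_inv g : affine_map R n :=
  AffineMap (- (invmx (aff_lin g) *m aff_shift g)) (aff_inv_unit g).

Lemma aff_invK g x : g (aff_inv g x) = x.
Proof.
rewrite /aff_fun/= -mulmxN -mulmxDr mulmxA mulmxV ?aff_lin_unit// mul1mx.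
by rewrite addNKr.
Qed.

Lemma aff_sub g x y : g x - g y = aff_lin g *m (x - y).
Proof. by rewrite /aff_fun opprD addrACA subrr add0r mulmxBr. Qed.

Lemma aff_inj g : injective g.
Proof.
move=> x y /eqP; rewrite -subr_eq0 aff_sub => /eqP gxy.
apply/eqP; rewrite -subr_eq0; apply/eqP.
by rewrite -[LHS](mulKmx (aff_lin_unit g)) gxy mulmx0.
Qed.

Lemma aff_act_id A : aff_act aff_id A = A.
Proof.
apply/convex_body_eq/seteqP; split=> [_ [x Ax <-]|x Ax].
  by rewrite aff_idE.
by exists x => //; exact: aff_idE.
Qed.

Lemma aff_act_comp g h A :
  aff_act (aff_comp g h) A = aff_act g (aff_act h A).
Proof.
apply/convex_body_eq/seteqP; split=> [_ [x Ax <-]|_ [_ [x Ax <-] <-]].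
  by rewrite aff_compE; exists (h x) => //; exists x.
by exists x => //; exact: aff_compE.
Qed.

Lemma aff_actK g A : aff_act (aff_inv g) (aff_act g A) = A.
Proof.
rewrite -aff_act_comp -[RHS]aff_act_id.
apply/convex_body_eq; rewrite /=; congr (_ @` _); apply/funext => x.
by apply: (@aff_inj g); rewrite aff_compE aff_invK aff_idE.
Qed.

Lemma body_dist_act g h A B (rho : R) :
  (forall a, body_set A a -> enorm a <= rho) ->
  body_dist (aff_act g A) (aff_act h B) <=
  enorm (aff_shift g - aff_shift h) + col_norm (aff_lin g - aff_lin h) * rho
  + col_norm (aff_lin h) * body_dist A B.
Proof.
move=> Arho; rewrite (le_trans (body_dist_triangle (aff_act h A) _ _))//.
have gh a : body_set A a -> edist (g a) (h a) <=
    enorm (aff_shift g - aff_shift h) + col_norm (aff_lin g - aff_lin h) * rho.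
  move=> Aa; rewrite /edist /aff_fun opprD addrACA -mulmxBl.
  rewrite (le_trans (enormD _ _))// lerD2l (le_trans (enorm_mulmx _ _))//.
  by rewrite ler_wpM2l ?col_norm_ge0// Arho.
have hh a b : edist (h a) (h b) <= col_norm (aff_lin h) * edist a b.
  by rewrite /edist aff_sub enorm_mulmx.
apply: lerD; apply: body_dist_le.
- by move=> _ [a Aa <-]; exists (h a); [exists a|exact: gh].
- by move=> _ [a Aa <-]; exists (g a); [exists a|rewrite edistC; exact: gh].
- move=> _ [a Aa <-]; have [b Bb ab] := body_dist_near B Aa.
  exists (h b); first by exists b.
  by rewrite (le_trans (hh _ _))// ler_wpM2l ?col_norm_ge0.
- move=> _ [b Bb <-]; have [a Aa ab] := body_dist_near A Bb.
  exists (h a); first by exists a.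
  by rewrite (le_trans (hh _ _))// body_distC ler_wpM2l ?col_norm_ge0.
Qed.

(** An affine map carries a proof of invertibility, so convergence is stated on
    the coefficients and not through a topology on the record. *)
Definition aff_cvg (I : Type) (F : set_system I) (g : I -> affine_map R n) h :=
  (aff_shift (g t) @[t --> F] --> aff_shift h) /\
  (aff_lin (g t) @[t --> F] --> aff_lin h).

Lemma cvg_aff (I : Type) (F : set_system I) {FF : Filter F}
    (g : I -> affine_map R n) h (y : I -> 'cV[R]_n) z :
  aff_cvg F g h -> y t @[t --> F] --> z -> g t (y t) @[t --> F] --> h z.
Proof. by move=> [gs gl] yz; apply: cvgD => //; exact: cvg_mulmx. Qed.

Lemma cvg_aff_act (I : Type) (F : set_system I) {FF : Filter F}
    (g : I -> affine_map R n) h (A : I -> convex_body R n) B :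
  aff_cvg F g h -> A t @[t --> F] --> B ->
  aff_act (g t) (A t) @[t --> F] --> aff_act h B.
Proof.
move=> [gs gl] /cvg_bodyP AB; apply/cvg_bodyP.
have [rho rho0 Brho] := body_bounded B.
have bound : enorm (aff_shift (g t) - aff_shift h) +
    col_norm (aff_lin (g t) - aff_lin h) * (rho + body_dist B (A t)) +
    col_norm (aff_lin h) * body_dist B (A t) @[t --> F] --> (0 : R).
  have -> : (0 : R) = 0 + 0 * (rho + 0) + col_norm (aff_lin h) * 0.
    by rewrite mul0r mulr0 !addr0.
  apply: cvgD; last by apply: cvgM => //; exact: cvg_cst.
  apply: cvgD.
    by rewrite -(edistxx (aff_shift h)); exact: cvg_edist.
  apply: cvgM; first exact: cvg_col_norm0.
  by apply: cvgD => //; exact: cvg_cst.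
apply: squeeze_cvgr (cvg_cst (0 : R)) bound; apply: filterE => t.
rewrite body_dist_ge0/= body_distC [in X in _ <= _ + X]body_distC.
apply: body_dist_act => a Aa; have [b Bb ab] := body_dist_near B Aa.
rewrite -(subrK b a) addrC body_distC (le_trans (enormD _ _))//.
by rewrite lerD// Brho.
Qed.

End affine_maps.

(** * Minimal width *)

Section width.
Context {R : realType} {n : nat}.
Implicit Types (A B C : convex_body R n) (u x y : 'cV[R]_n).

Definition dir_width u A : R :=
  sup [set dot u (a.1 - a.2) | a in [set a | body_set A a.1 /\ body_set A a.2]].

Definition width A : R := inf [set dir_width u A | u in [set u | enorm u = 1]].

Lemma dir_width_ge u A x y : body_set A x -> body_set A y ->
  dot u (x - y) <= dir_width u A.
Proof.
move=> Ax Ay; apply: ub_le_sup; last by exists (x, y).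
have [rho rho0 Arho] := body_bounded A.
exists (enorm u * (rho + rho)) => _ [[a b] /= [Aa Ab] <-].
rewrite (le_trans (dot_le _ _))// ler_wpM2l ?enorm_ge0//.
by rewrite (le_trans (enormB _ _))// lerD// Arho.
Qed.

Lemma dir_width_le u A (w : R) :
  (forall x y, body_set A x -> body_set A y -> dot u (x - y) <= w) ->
  dir_width u A <= w.
Proof.
move=> h; apply: ge_sup; last by move=> _ [[a b] /= [Aa Ab] <-]; exact: h.
by have [a Aa] := body_nonempty A; exists (dot u (a - a)), (a, a).
Qed.

Lemma dir_width_ge0 u A : 0 <= dir_width u A.
Proof.
have [a Aa] := body_nonempty A.
by have := dir_width_ge u Aa Aa; rewrite dotB subrr.
Qed.

Lemma width_le u A : enorm u = 1 -> width A <= dir_width u A.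
Proof.
move=> u1; apply: ge_inf; last by exists u.
by exists 0 => _ [v _ <-]; exact: dir_width_ge0.
Qed.

Lemma width_ge A (w : R) : (0 < n)%N ->
  (forall u, enorm u = 1 -> w <= dir_width u A) -> w <= width A.
Proof.
move=> n0 h; apply: lb_le_inf; last by move=> _ [u u1 <-]; exact: h.
pose u : 'cV[R]_n := delta_mx (Ordinal n0) 0.
by exists (dir_width u A), u => //=; exact: enorm_delta.
Qed.

Lemma width_gt0 A : (0 < n)%N -> 0 < width A.
Proof.
move=> n0; have [a [r r0 ar]] := body_ball A.
suff : 2 * r <= width A by apply: lt_le_trans; rewrite mulr_gt0.
apply: width_ge => // u u1.
have ru : enorm (r *: u) = r by rewrite enormZ u1 mulr1 gtr0_norm.
have -> : 2 * r = dot u ((a + r *: u) - (a + - (r *: u))).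
  rewrite opprD opprK addrACA subrr add0r -scalerDl.
  by rewrite /dot -scalemxAr mxE -/(dot u u) dotuu u1 expr1n mulr1 mulr_natl.
by apply: dir_width_ge; apply: ar; rewrite ?enormN ru.
Qed.

(** Moving two points by at most [d] changes the product of their difference with
    a unit vector by at most [2 d]. *)
Lemma width_lipschitz A B : (0 < n)%N ->
  width A <= width B + 2 * body_dist A B.
Proof.
move=> n0; rewrite -lerBlDr; apply: width_ge => // u u1.
rewrite lerBlDr (le_trans (width_le A u1))//; apply: dir_width_le => x y Ax Ay.
have [x' Bx xx'] := body_dist_near B Ax; have [y' By yy'] := body_dist_near B Ay.
have -> : dot u (x - y) =
    dot u (x' - y') + (dot u (x - x') + dot u (y' - y)).
  by rewrite !dotB; ring.
have d1 := dot_le u (x - x'); have d2 := dot_le u (y' - y).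
move: d1 d2; rewrite u1 !mul1r -!/(edist _ _) [edist y' y]edistC => d1 d2.
have := dir_width_ge u Bx By; lra.
Qed.

Lemma continuous_width : (0 < n)%N -> continuous width.
Proof.
move=> n0 A.
have dA := cvg_body_dist0 A.
apply/(@cvgrPdist_le _ _ _ (nbhs A)) => e e0.
have e2 : 0 < e / 2 by rewrite divr_gt0.
move/cvgrPdist_lt : dA => /(_ _ e2); apply: filterS => B.
rewrite sub0r normrN ger0_norm ?body_dist_ge0// => AB.
have := width_lipschitz A B n0; have := width_lipschitz B A n0.
by rewrite (body_distC B A) ler_norml => ? ?; apply/andP; split; lra.
Qed.

(** A map whose transpose nearly kills [u] squeezes [A] in the direction [u], so a
    lower bound on the width of images keeps linear parts away from singular
    ones. *)
Lemma width_act_le u (g : affine_map R n) A (rho : R) : enorm u = 1 ->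
  (forall a, body_set A a -> enorm a <= rho) ->
  width (aff_act g A) <= enorm ((aff_lin g)^T *m u) * (rho + rho).
Proof.
move=> u1 Arho; rewrite (le_trans (width_le _ u1))//; apply: dir_width_le.
move=> _ _ [a Aa <-] [b Ab <-]; rewrite aff_sub dot_mulmx.
rewrite (le_trans (dot_le _ _))// ler_wpM2l ?enorm_ge0//.
by rewrite (le_trans (enormB _ _))// lerD// Arho.
Qed.

End width.

(** * Properness of the affine action *)

Section discrepancy.
Context {R : realType} {n : nat}.
Hypothesis n_gt0 : (0 < n)%N.
Variable K : convex_body R n.
Implicit Types (A B : convex_body R n) (x y : 'cV[R]_n).

(** A measure of how far [A] is from [K]. The cube makes it outgrow the squared
    displacement of a point, and the inverse width makes it blow up on
    flattening bodies. *)
Definition discrepancy A : R :=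
  body_dist K A ^+ 3 + `|(width A)^-1 - (width K)^-1|.

Lemma dist_le_discrepancy A : body_dist K A ^+ 3 <= discrepancy A.
Proof. by rewrite lerDl. Qed.

Lemma discrepancy_ge0 A : 0 <= discrepancy A.
Proof. by rewrite addr_ge0// exprn_ge0// body_dist_ge0. Qed.

Lemma discrepancyKK : discrepancy K = 0.
Proof.
by rewrite /discrepancy body_distxx expr0n subrr normr0 addr0.
Qed.

Lemma discrepancy_eq0 A : discrepancy A = 0 -> A = K.
Proof.
move=> A0; apply/esym/body_dist_eq0/eqP.
have := dist_le_discrepancy A; rewrite A0 => dA.
have : body_dist K A ^+ 3 == 0.
  by rewrite eq_le dA exprn_ge0// body_dist_ge0.
by rewrite expf_eq0.
Qed.

Lemma continuous_discrepancy : continuous discrepancy.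
Proof.
move=> A.
have wA : (width B)^-1 @[B --> A] --> (width A)^-1.
  apply: (@cvgV _ _ (nbhs A)); first exact/lt0r_neq0/width_gt0.
  exact: continuous_width.
suff dA : body_dist K B @[B --> A] --> body_dist K A.
  have dA3 : body_dist K B ^+ 3 @[B --> A] --> body_dist K A ^+ 3.
    exact: cvg_comp dA (@exprn_continuous R 3 _).
  exact: cvgD dA3 (cvg_norm (cvgB wA (cvg_cst _))).
have dA := cvg_body_dist0 A.
apply/(@cvgrPdist_lt _ _ _ (nbhs A)) => e e0.
move/cvgrPdist_lt : dA => /(_ _ e0); apply: filterS => B.
rewrite sub0r normrN ger0_norm ?body_dist_ge0// => AB.
have := body_dist_triangle A K B; have := body_dist_triangle B K A.
by rewrite (body_distC B A) ltr_norml => ? ?; apply/andP; split; lra.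
Qed.

(** Bodies close to [A0] contain points near the 2n points [a +- r e_j] of a
    ball in [A0]; the images of these points lie near [K], which controls the
    columns of the linear part. A bound on one column involves an error
    proportional to the sum of all columns; [eta] is so small that the errors
    add up to at most half of that sum. *)
Lemma aff_coeff_bound A0 : exists eta c : R, [/\ 0 < eta, 0 <= c &
  forall A (g : affine_map R n), body_dist A0 A < eta ->
    enorm (aff_shift g) + col_norm (aff_lin g) <=
    c * (1 + body_dist K (aff_act g A))].
Proof.
have [a [r r0 ar]] := body_ball A0.
have [rhoK rhoK0 Krho] := body_bounded K.
have [rho rho0 A0rho] := body_bounded A0.
have n0 : 0 < n%:R :> R by rewrite ltr0n.
(* 2 n eta = r lets the error terms be absorbed when the column bounds are
   summed. *)
pose eta : R := r / (2 * n%:R).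
have eta0 : 0 < eta by rewrite divr_gt0// mulr_gt0.
pose c0 := 2 * n%:R / r * (rhoK + 1).
have c00 : 0 <= c0.
  by rewrite mulr_ge0 ?addr_ge0// divr_ge0 ?mulr_ge0// ltW.
exists eta, (rhoK + 1 + c0 * (1 + rho + eta)); split => //.
  by apply: addr_ge0; [lra|apply: mulr_ge0 => //; lra].
move=> A g A0A.
set d := body_dist K _; set S := col_norm _.
have d0 : 0 <= d by exact: body_dist_ge0.
have S0 : 0 <= S by exact: col_norm_ge0.
have gA b : body_set A b -> enorm (g b) <= rhoK + d.
  move=> Ab; have gAb : body_set (aff_act g A) (g b) by exists b.
  have [k Kk gbk] := body_dist_near K gAb.
  rewrite -(subrK k (g b)) addrC (le_trans (enormD _ _))// lerD ?Krho//.
  by rewrite /d body_distC.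
have colj j : r * enorm (col j (aff_lin g)) <= rhoK + d + eta * S.
  have near (s : R) : `|s| = r -> exists2 b, body_set A b &
      enorm (b - (a + s *: delta_mx j 0)) <= eta.
    move=> sr; have /(body_dist_near A)[b Ab ab] :
        body_set A0 (a + s *: delta_mx j 0).
      by apply: ar; rewrite enormZ sr enorm_delta mulr1.
    exists b => //; rewrite -/(edist _ _) edistC (le_trans ab)//; exact: ltW.
  have [|b Ab be] := near r; first exact: gtr0_norm.
  have [|b' Ab' be'] := near (- r); first by rewrite normrN gtr0_norm.
  pose err : 'cV[R]_n :=
    (b - (a + r *: delta_mx j 0)) - (b' - (a + - r *: delta_mx j 0)).
  have errE : (2 * r) *: col j (aff_lin g) =
      (g b - g b') - aff_lin g *m err.
    rewrite aff_sub -mulmxBr.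
    have -> : b - b' - err = (2 * r) *: delta_mx j 0.
      by apply/colP => i; rewrite !mxE; ring.
    by rewrite -scalemxAr -colE.
  have errle : enorm (aff_lin g *m err) <= S * (eta + eta).
    rewrite (le_trans (enorm_mulmx _ _))// ler_wpM2l//.
    by rewrite (le_trans (enormB _ _))// lerD.
  have : 2 * r * enorm (col j (aff_lin g)) <=
      (rhoK + d + (rhoK + d)) + S * (eta + eta).
    rewrite -[X in X * enorm _]gtr0_norm ?mulr_gt0// -enormZ errE.
    rewrite (le_trans (enormB _ _))// lerD// (le_trans (enormB _ _))//.
    by rewrite lerD// gA.
  lra.
have Sle : S <= c0 * (1 + d).
  have : r * S <= n%:R * (rhoK + d + eta * S).
    rewrite /S /col_norm mulr_sumr.
    rewrite -[X in _ <= X%:R * _]card_ord -sum1_card natr_sum mulr_suml.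
    by apply: ler_sum => j _; rewrite mul1r colj.
  have -> : n%:R * (rhoK + d + eta * S) = n%:R * (rhoK + d) + r / 2 * S.
    by rewrite /eta; field; rewrite gt_eqF.
  move=> h; have {}h : S <= 2 * n%:R / r * (rhoK + d).
    by rewrite mulrAC ler_pdivlMr//; lra.
  rewrite (le_trans h)// /c0 -[leRHS]mulrA.
  rewrite ler_wpM2l ?divr_ge0 ?mulr_ge0 ?ltW//; nra.
have [b0 Ab0] := body_nonempty A.
have b0le : enorm b0 <= rho + eta.
  have [a0 Aa0 ab0] := body_dist_near A0 Ab0.
  rewrite -(subrK a0 b0) addrC (le_trans (enormD _ _))// lerD ?A0rho//.
  by rewrite (le_trans ab0)// body_distC ltW.
have shiftle : enorm (aff_shift g) <= rhoK + d + S * (rho + eta).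
  have -> : aff_shift g = g b0 - aff_lin g *m b0 by rewrite /aff_fun addrK.
  rewrite (le_trans (enormB _ _))// lerD ?gA// (le_trans (enorm_mulmx _ _))//.
  by rewrite ler_wpM2l.
have Se : S * (rho + eta) <= c0 * (1 + d) * (rho + eta).
  by rewrite ler_wpM2r// addr_ge0// ltW.
nra.
Qed.

(** Properness of the action: bounded distance to [K] bounds the coefficients, so
    the maps have a limit, and bounded inverse width keeps this limit from being
    singular. *)
Lemma discrepancy_proper (I : Type) (U : set_system I) {UU : UltraFilter U}
    (A : I -> convex_body R n) A0 (g : I -> affine_map R n) (c : R) :
  A t @[t --> U] --> A0 ->
  (\forall t \near U, discrepancy (aff_act (g t) (A t)) <= c) ->
  exists h, aff_cvg U g h.
Proof.
move=> /cvg_bodyP/cvgrPdist_lt AA0 gc.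
have near0 (e : R) : 0 < e -> \forall t \near U, body_dist A0 (A t) < e.
  move=> e0; apply: filterS (AA0 e e0) => t.
  by rewrite sub0r normrN ger0_norm// body_dist_ge0.
have [eta [C [eta0 C0 gC]]] := aff_coeff_bound A0.
have coeff : \forall t \near U,
    enorm (aff_shift (g t)) + col_norm (aff_lin (g t)) <= C * (2 + c).
  apply: filterS2 gc (near0 _ eta0) => t gtc /gC /le_trans; apply.
  rewrite ler_wpM2l//; have := le_trans (dist_le_discrepancy _) gtc.
  have := body_dist_ge0 K (aff_act (g t) (A t)).
  have := le_trans (discrepancy_ge0 _) gtc.
  set d := body_dist _ _ => c0 d0 d3.
  have [dc|cd] := leP d (1 + c); first lra.
  suff : c < d ^+ 3 by rewrite ltNge d3.
  have d1 : 1 <= d ^+ 2 by rewrite exprn_ege1//; lra.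
  by rewrite exprS; nra.
have [v gv] : exists v : 'cV[R]_n, aff_shift (g t) @[t --> U] --> v.
  apply: (@ultra_bounded_cvg _ _ _ _ U _ _ (C * (2 + c))).
  apply: filterS coeff => t gt i j; rewrite ord1.
  rewrite (le_trans (coord_le_enorm _ i))// (le_trans _ gt)//.
  by rewrite lerDl col_norm_ge0.
have [s gs] : exists s : 'M[R]_n, aff_lin (g t) @[t --> U] --> s.
  apply: (@ultra_bounded_cvg _ _ _ _ U _ _ (C * (2 + c))).
  apply: filterS coeff => t gt i j; rewrite (le_trans _ gt)//.
  have := coord_le_enorm (col j (aff_lin (g t))) i; rewrite mxE => /le_trans.
  apply; rewrite /col_norm (bigD1 j)//= addrCA lerDl addr_ge0 ?enorm_ge0//.
  by apply: sumr_ge0 => k _; exact: enorm_ge0.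
suff su : s \in unitmx by exists (AffineMap v su).
(* A unit vector killed by the transpose of the limit would force the width of
   the images, which is bounded below, to tend to 0. *)
rewrite unitmxE unitfE; apply/negP => /det0P[w w0 ws].
pose u : 'cV[R]_n := (enorm w^T)^-1 *: w^T.
have w0' : enorm w^T != 0.
  by apply: contra_neq w0 => /enorm_eq0/(congr1 trmx); rewrite trmxK trmx0.
have u1 : enorm u = 1.
  by rewrite enormZ ger0_norm ?invr_ge0 ?enorm_ge0// mulVf.
have su : s^T *m u = 0 by rewrite -scalemxAr -trmx_mul ws trmx0 scaler0.
have [rho rho0 A0rho] := body_bounded A0.
have Kw : 0 < (width K)^-1 by rewrite invr_gt0 width_gt0.
have lower : \forall t \near U, (c + (width K)^-1)^-1 <=
    enorm ((aff_lin (g t))^T *m u) * (rho + 1 + (rho + 1)).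
  apply: filterS2 gc (near0 1 ltr01) => t gtc A0A.
  apply: le_trans (@width_act_le _ _ u (g t) (A t) (rho + 1) u1 _); last first.
    move=> a Aa; have [b Ab ab] := body_dist_near A0 Aa.
    rewrite -(subrK b a) addrC (le_trans (enormD _ _))// lerD ?A0rho//.
    by rewrite (le_trans ab)// body_distC ltW.
  have w1 := width_gt0 (aff_act (g t) (A t)) n_gt0.
  rewrite -[leRHS]invrK lef_pV2 ?posrE ?invr_gt0//; last first.
    by rewrite ltr_wpDl// (le_trans (discrepancy_ge0 _) gtc).
  rewrite -lerBlDr (le_trans (ler_norm _))// (le_trans _ gtc)//.
  by rewrite lerDr exprn_ge0// body_dist_ge0.
have [t0 t0c] : exists t, discrepancy (aff_act (g t) (A t)) <= c.
  exact: filter_ex gc.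
have : (c + (width K)^-1)^-1 <= 0 * (rho + 1 + (rho + 1)).
  apply: (@cvg_le_near _ _ U _ _ _ _ _ (cvg_cst _) _ lower).
  apply: cvgM; last exact: cvg_cst.
  rewrite -[X in _ --> X](edistxx (0 : 'cV[R]_n)) -{1}su.
  under eq_fun do rewrite -[X in enorm X]subr0.
  apply: cvg_edist; apply: cvg_mulmx; last exact: cvg_cst.
  apply: cvg_mx => i j; rewrite mxE; under eq_fun do rewrite mxE.
  exact: cvg_coord.
apply/negP; rewrite -ltNge mul0r invr_gt0 ltr_wpDl//.
exact: le_trans (discrepancy_ge0 _) t0c.
Qed.

End discrepancy.

(** * A penalty that dominates the displacement of the fixed point *)

Section majorant.
Context {R : realType} {n : nat}.
Hypothesis n_gt0 : (0 < n)%N.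
Variables (K : convex_body R n) (x : 'cV[R]_n).
Implicit Types (A B : convex_body R n) (y : 'cV[R]_n) (g : affine_map R n).

(** This is where the cube in the discrepancy is used: a squared displacement
    grows at most like the square of the distance to [K]. *)
Lemma discrepancy_le_bounded A0 (rho c : R) : 0 <= rho ->
  exists eta b : R, 0 < eta /\
  forall A g y, body_dist A0 A < eta -> enorm y <= rho ->
    discrepancy K (aff_act g A) <= edist (g y) x ^+ 2 + c ->
    discrepancy K (aff_act g A) <= b.
Proof.
move=> rho0; have [eta [C [eta0 C0 gC]]] := aff_coeff_bound n_gt0 K A0.
pose M := C * (1 + rho) + enorm x.
have M0 : 0 <= M by rewrite addr_ge0 ?enorm_ge0// mulr_ge0// addr_ge0.
(* Beyond D the inequality d^3 <= M^2 (1 + d)^2 + c fails. *)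
pose D := 1 + 4 * M ^+ 2 + `|c|.
exists eta, (M ^+ 2 * (1 + D) ^+ 2 + c); split => // A g y A0A yrho.
set d := body_dist K (aff_act g A); set T := discrepancy _ _.
have d0 : 0 <= d by exact: body_dist_ge0.
have dT : d ^+ 3 <= T by exact: dist_le_discrepancy.
have disp : edist (g y) x <= M * (1 + d).
  have gd := gC A g A0A; rewrite -/d in gd.
  have s0 := enorm_ge0 (aff_shift g); have l0 := col_norm_ge0 (aff_lin g).
  have e1 : enorm (g y) <=
      enorm (aff_shift g) + col_norm (aff_lin g) * rho.
    rewrite /aff_fun (le_trans (enormD _ _))// lerD2l.
    by rewrite (le_trans (enorm_mulmx _ _))// ler_wpM2l.
  have := enormB (g y) x; rewrite -/(edist _ _) /M => e2.
  have x0 := enorm_ge0 x.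
  have e3 : enorm (aff_shift g) + col_norm (aff_lin g) * rho <=
      (enorm (aff_shift g) + col_norm (aff_lin g)) * (1 + rho) by nra.
  have e4 : (enorm (aff_shift g) + col_norm (aff_lin g)) * (1 + rho) <=
      C * (1 + d) * (1 + rho) by rewrite ler_wpM2r// addr_ge0.
  nra.
have disp2 : edist (g y) x ^+ 2 <= M ^+ 2 * (1 + d) ^+ 2.
  by rewrite -exprMn lerXn2r ?nnegrE ?edist_ge0// mulr_ge0// addr_ge0.
move=> Tle; have M2 : 0 <= M ^+ 2 by exact: sqr_ge0.
have cc := ler_norm c; have c0 := normr_ge0 c.
suff dD : d <= D.
  rewrite (le_trans Tle)// lerD2r (le_trans disp2)// ler_wpM2l//.
  by rewrite lerXn2r ?nnegrE ?addr_ge0 ?mulr_ge0// lerD2l.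
rewrite leNgt; apply/negP => Dd.
have d1 : 1 <= d by rewrite /D in Dd; lra.
have h1 : M ^+ 2 * (1 + d) ^+ 2 <= 4 * M ^+ 2 * d ^+ 2.
  by rewrite -[leRHS]mulrA [leRHS]mulrCA ler_wpM2l//; nra.
have h2 : d ^+ 2 * (d - 4 * M ^+ 2) <= `|c|.
  by rewrite mulrBr -exprSr; lra.
have h3 : 1 + `|c| < d - 4 * M ^+ 2 by rewrite /D in Dd; lra.
have h4 : 1 <= d ^+ 2 by rewrite exprn_ege1.
nra.
Qed.

Hypothesis x_fixed : affine_fixed_set K x.

(** Compactness turns the hypothesis that the symmetries of [K] fix [x] into a
    quantitative one: maps that nearly preserve [K] nearly fix [x]. Otherwise
    there are maps with [N = 1, 2, ...] violating the bound; their discrepancies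
    tend to 0, so they accumulate at a symmetry of [K] moving [x]. *)
Lemma displacement_le (e : R) : 0 < e -> exists2 N : R, 1 <= N &
  forall g, edist (g x) x ^+ 2 <= e + N * discrepancy K (aff_act g K).
Proof.
move=> e0; apply: contrapT => noN.
have /choice[g gP] : forall k : nat, exists g : affine_map R n,
    e + k.+1%:R * discrepancy K (aff_act g K) < edist (g x) x ^+ 2.
  move=> k; apply: contrapT => /forallNP nog; apply: noN; exists k.+1%:R.
    by rewrite ler1n.
  by move=> g; rewrite leNgt; apply/negP/nog.
pose T k := discrepancy K (aff_act (g k) K).
have T0 k : 0 <= T k by exact: discrepancy_ge0.
have [U [UU ooU]] := ultraFilterLemma (@eventually_filter).
have [eta [b [eta0 Tb]]] := discrepancy_le_bounded K 0 (enorm_ge0 x).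
have [h gh] : exists h, aff_cvg U g h.
  apply: (discrepancy_proper n_gt0 (K := K) (A := fun=> K) (c := b)).
    exact: cvg_cst.
  apply: filterE => k; apply: (Tb K (g k) x) => //; first by rewrite body_distxx.
  rewrite addr0 (le_trans _ (ltW (gP k)))// -/(T k).
  have := T0 k; have : 1 <= k.+1%:R :> R by rewrite ler1n.
  nra.
have ghx : edist (g k x) x ^+ 2 @[k --> U] --> edist (h x) x ^+ 2.
  have hx : edist (g k x) x @[k --> U] --> edist (h x) x.
    by apply: cvg_edist; apply: cvg_aff gh _; exact: cvg_cst.
  exact: cvg_comp hx (@exprn_continuous R 2 _).
have Th : T k @[k --> U] --> discrepancy K (aff_act h K).
  have gK : aff_act (g k) K @[k --> U] --> aff_act h K.
    by apply: cvg_aff_act gh _; exact: cvg_cst.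
  exact: cvg_comp gK (@continuous_discrepancy _ _ n_gt0 K _).
have harm : k.+1%:R^-1 @[k --> U] --> (0 : R).
  by move=> A /(@cvg_harmonic R) nA; exact: ooU.
have hK : aff_act h K = K.
  apply: discrepancy_eq0; apply/eqP.
  rewrite eq_le discrepancy_ge0 andbT -(mul0r (edist (h x) x ^+ 2)).
  apply: cvg_le_near Th (cvgM harm ghx) _; apply: filterE => k /=.
  rewrite mulrC ler_pdivlMr ?ltr0n// mulrC ltW//.
  by rewrite (le_lt_trans _ (gP k))// lerDr ltW.
have : e <= edist (h x) x ^+ 2.
  apply: cvg_le_near (cvg_cst e) ghx _; apply: filterE => k.
  by rewrite (le_trans _ (ltW (gP k)))// lerDl mulr_ge0// T0.
by rewrite (x_fixed hK) edistxx expr0n /= leNgt e0.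
Qed.

(** Second components below 1 are excluded so that the infimum below dominates the
    discrepancy and inherits its growth. *)
Definition admissible (p : R * R) := [/\ 0 < p.1, 1 <= p.2 &
  forall g, edist (g x) x ^+ 2 <= p.1 + p.2 * discrepancy K (aff_act g K)].

(** As an infimum of affine functions of the discrepancy this is a concave
    function of it, which gives its continuity away from [K]. *)
Definition majorant A : R :=
  inf [set p.1 + p.2 * discrepancy K A | p in admissible].

Lemma majorant_le p A : admissible p ->
  majorant A <= p.1 + p.2 * discrepancy K A.
Proof.
move=> adm; apply: ge_inf; last by exists p.
exists 0 => _ [[e N] /= [/= e0 N1 _] <-].
by rewrite addr_ge0 ?mulr_ge0 ?discrepancy_ge0//; lra.
Qed.

Lemma admissible_nonempty : admissible !=set0.
Proof.
by have [N N1 NP] := displacement_le ltr01; exists (1, N); split => /=.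
Qed.

Lemma le_majorant (r : R) A :
  (forall p, admissible p -> r <= p.1 + p.2 * discrepancy K A) ->
  r <= majorant A.
Proof.
move=> rP; apply: lb_le_inf; last by move=> _ [p adm <-]; exact: rP.
by have [p adm] := admissible_nonempty; exists (p.1 + p.2 * discrepancy K A), p.
Qed.

Lemma discrepancy_le_majorant A : discrepancy K A <= majorant A.
Proof.
apply: le_majorant => p [p0 p1 _]; have := discrepancy_ge0 K A; nra.
Qed.

(** The discrepancy of [K] is 0, and pairs with arbitrarily small first component
    are admissible: this is where [displacement_le] is used for small [e]. *)
Lemma majorantKK : majorant K = 0.
Proof.
apply/eqP; rewrite eq_le.
rewrite (le_trans _ (discrepancy_le_majorant K)) ?andbT; last first.
  exact: discrepancy_ge0.
apply/ler_addgt0Pl => e e0; rewrite addr0.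
have [N N1 NP] := displacement_le e0.
have adm : admissible (e, N) by split.
by have := majorant_le K adm; rewrite discrepancyKK mulr0 addr0.
Qed.

Lemma displacement_le_majorant g : edist (g x) x ^+ 2 <= majorant (aff_act g K).
Proof. by apply: le_majorant => p [_ _]; exact. Qed.

(** Near [A] the infimum exceeds its value at [A] by little, since one nearly
    optimal pair serves all bodies near [A]; that it does not drop below that
    value follows from concavity, or from [majorantKK] if [A] is [K]. *)
Lemma continuous_majorant : continuous majorant.
Proof.
move=> A.
have dA : discrepancy K B @[B --> A] --> discrepancy K A.
  exact: continuous_discrepancy.
have ge0 B : 0 <= discrepancy K B by exact: discrepancy_ge0.
apply/(@cvgrPdist_le _ _ _ (nbhs A)) => e e0.
have upper : \forall B \near A, majorant B <= majorant A + e.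
  have [p adm pA] : exists2 p, admissible p &
      p.1 + p.2 * discrepancy K A < majorant A + e.
    have [|_ [p adm <-] pA] := @inf_adherent _
      [set p.1 + p.2 * discrepancy K A | p in admissible] e e0; last by exists p.
    split; first by have [p adm] := admissible_nonempty;
      exists (p.1 + p.2 * discrepancy K A), p.
    exists (majorant A) => _ [p adm <-]; exact: majorant_le.
  have dp : p.1 + p.2 * discrepancy K B @[B --> A] -->
      p.1 + p.2 * discrepancy K A.
    exact: cvgD (cvg_cst _) (cvgM (cvg_cst _) dA).
  apply: (filterS _ (@cvgr_lt _ _ (nbhs A) _ _ _ dp _ pA)) => B /ltW.
  by apply: le_trans; exact: majorant_le.
have lower : \forall B \near A, majorant A <= majorant B + e.
  have [A0|A0] := eqVneq (discrepancy K A) 0.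
    apply: filterE => B.
    rewrite (discrepancy_eq0 A0) majorantKK addr_ge0 ?(ltW e0)//.
    exact: le_trans (ge0 B) (discrepancy_le_majorant B).
  have {}A0 : 0 < discrepancy K A by rewrite lt_neqAle eq_sym A0 (ge0 A).
  have mA : 0 <= majorant A := le_trans (ge0 A) (discrepancy_le_majorant A).
  (* Multiplying the discrepancy t by a factor at most 1 multiplies each
     e + N t, hence the majorant, by at least the same factor. *)
  have conc B : discrepancy K B <= discrepancy K A ->
      discrepancy K B / discrepancy K A * majorant A <= majorant B.
    move=> BA; apply: le_majorant => p adm; have [p0 p1 _] := adm.
    have s1 : discrepancy K B / discrepancy K A <= 1.
      by rewrite ler_pdivrMr ?mul1r.
    have s0 : 0 <= discrepancy K B / discrepancy K A.
      by rewrite divr_ge0// ltW.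
    rewrite (le_trans (ler_wpM2l s0 (majorant_le A adm)))// mulrDr.
    rewrite mulrCA divfK ?gt_eqF// lerD2r; nra.
  have mono B : discrepancy K A <= discrepancy K B -> majorant A <= majorant B.
    move=> AB; apply: le_majorant => p adm; have [p0 p1 _] := adm.
    by rewrite (le_trans (majorant_le A adm))// lerD2l ler_wpM2l//; lra.
  have dq : discrepancy K B / discrepancy K A * majorant A @[B --> A] -->
      discrepancy K A / discrepancy K A * majorant A.
    exact: cvgM (cvgM dA (cvg_cst _)) (cvg_cst _).
  have Ae : majorant A - e < discrepancy K A / discrepancy K A * majorant A.
    by rewrite divff ?gt_eqF// mul1r ltrBlDr ltrDl.
  apply: (filterS _ (@cvgr_gt _ _ (nbhs A) _ _ _ dq _ Ae)) => B BAe.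
  by have [/conc AB|/ltW/mono AB] := leP (discrepancy K B) (discrepancy K A); lra.
apply: (@filterS2 _ (nbhs A) _ _ _ _ _ upper lower) => B up low.
by rewrite ler_norml; apply/andP; split; lra.
Qed.

End majorant.

(** * The minimizer as an affine invariant point *)

Section affine_point.
Context {R : realType} {n : nat}.
Hypothesis n_gt0 : (0 < n)%N.
Variables (K : convex_body R n) (x : 'cV[R]_n).
Hypothesis x_fixed : affine_fixed_set K x.
Implicit Types (A B : convex_body R n) (y z : 'cV[R]_n) (g h : affine_map R n).

Definition score A g y : R := edist (g y) x ^+ 2 - majorant K x (aff_act g A).

Lemma score_act A g h y : score (aff_act h A) g (h y) = score A (aff_comp g h) y.
Proof. by rewrite /score aff_act_comp aff_compE. Qed.

Lemma cvg_majorant (I : Type) (F : set_system I) {FF : Filter F}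
    (A : I -> convex_body R n) B : A t @[t --> F] --> B ->
  majorant K x (A t) @[t --> F] --> majorant K x B.
Proof.
by move=> AB; exact: cvg_comp AB (@continuous_majorant _ _ n_gt0 K x x_fixed B).
Qed.

Lemma cvg_score (I : Type) (F : set_system I) {FF : Filter F}
    (A : I -> convex_body R n) B (g : I -> affine_map R n) h
    (y : I -> 'cV[R]_n) z :
  A t @[t --> F] --> B -> aff_cvg F g h -> y t @[t --> F] --> z ->
  score (A t) (g t) (y t) @[t --> F] --> score B h z.
Proof.
move=> AB gh yz; apply: cvgB (cvg_majorant (cvg_aff_act gh AB)).
exact: cvg_comp (cvg_edist (cvg_aff gh yz)) (@exprn_continuous R 2 _).
Qed.

(** The penalty dominates the discrepancy, which grows faster than the squared
    displacement; so a lower bound on the score bounds the discrepancy. *)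
Lemma score_proper (I : Type) (U : set_system I) {UU : UltraFilter U}
    (A : I -> convex_body R n) B (g : I -> affine_map R n)
    (y : I -> 'cV[R]_n) z (c : R) :
  A t @[t --> U] --> B -> y t @[t --> U] --> z ->
  (\forall t \near U, c <= score (A t) (g t) (y t)) ->
  exists h, aff_cvg U g h.
Proof.
move=> AB yz gc.
have z0 : 0 <= enorm z + 1 by rewrite addr_ge0 ?enorm_ge0.
have [eta [b [eta0 Tb]]] := discrepancy_le_bounded n_gt0 K x B (- c) z0.
apply: (discrepancy_proper n_gt0 (K := K) (c := b) AB).
have yle : \forall t \near U, enorm (y t) < enorm z + 1.
  have dy : enorm (y t) @[t --> U] --> enorm z.
    rewrite -(subr0 z); under eq_fun do rewrite -[y _]subr0.
    exact: cvg_edist.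
  by apply: (cvgr_lt _ dy); rewrite ltrDl.
have Ale : \forall t \near U, body_dist B (A t) < eta.
  by have /cvg_bodyP dB := AB; exact: (cvgr_lt _ dB).
apply: filterS3 yle Ale gc => t /ltW yt At; rewrite /score => sc.
apply: (Tb _ _ _ At yt).
by have := discrepancy_le_majorant n_gt0 x_fixed (aff_act (g t) (A t)); lra.
Qed.

(** A maximizing family of maps has a nonsingular limit by properness, and the
    score is continuous in the map. *)
Lemma score_max A y : exists h, forall g, score A g y <= score A h y.
Proof.
have [U [UU Umax]] := ultra_maximizing aff_id (fun g => score A g y).
have [h Uh] := score_proper (g := id) (cvg_cst A) (cvg_cst y) (Umax aff_id).
exists h => g.
exact: cvg_le_near (cvg_cst _) (cvg_score (cvg_cst A) Uh (cvg_cst y)) (Umax g).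
Qed.

Definition best A y : affine_map R n := projT1 (cid (score_max A y)).

Definition value A y : R := score A (best A y) y.

Lemma score_le_value A g y : score A g y <= value A y.
Proof. exact: (projT2 (cid (score_max A y))). Qed.

(** The change of variable [g |-> g h^-1] in the supremum. *)
Lemma value_act A h y : value (aff_act h A) (h y) = value A y.
Proof.
apply/eqP; rewrite eq_le; apply/andP; split; rewrite {1}/value.
  by rewrite score_act score_le_value.
set g := best A y.
have -> : score A g y = score (aff_act h A) (aff_comp g (aff_inv h)) (h y).
  rewrite /score aff_act_comp aff_actK aff_compE.
  by congr (edist (g _) x ^+ 2 - _); apply: (@aff_inj _ _ h); rewrite aff_invK.
exact: score_le_value.
Qed.

(** With [score_le_value] this gives the upper semicontinuity of the value in
    the body, at a fixed point [z]. *)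
Lemma value_cvg (I : Type) (U : set_system I) {UU : UltraFilter U}
    (A : I -> convex_body R n) B z : A t @[t --> U] --> B ->
  exists h, value (A t) z @[t --> U] --> score B h z.
Proof.
move=> AB.
have id_cvg : aff_cvg U (fun=> aff_id) (aff_id : affine_map R n).
  by split; exact: cvg_cst.
have sid : score (A t) aff_id z @[t --> U] --> score B aff_id z.
  exact: cvg_score AB id_cvg (cvg_cst z).
have [|h Uh] := score_proper (g := fun t => best (A t) z)
    (c := score B aff_id z - 1) AB (cvg_cst z).
  have sgt : \forall t \near U, score B aff_id z - 1 < score (A t) aff_id z.
    by apply: (cvgr_gt _ sid); rewrite ltrBlDr ltrDl.
  apply: filterS sgt => t /ltW/le_trans; apply; exact: score_le_value.
by exists h; exact: cvg_score AB Uh (cvg_cst z).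
Qed.

(** Minimizers for bodies tending to [B] stay bounded, because the identity map
    alone makes the value coercive, and their limit minimizes the value of [B]:
    the value is jointly lower semicontinuous as a supremum of continuous
    functions. *)
Lemma minimizers_cvg (I : Type) (U : set_system I) {UU : UltraFilter U}
    (A : I -> convex_body R n) B (y : I -> 'cV[R]_n) :
  A t @[t --> U] --> B ->
  (forall z, \forall t \near U, value (A t) (y t) <= value (A t) z) ->
  exists2 y0, y t @[t --> U] --> y0 & forall z, value B y0 <= value B z.
Proof.
move=> AB ymin.
have const_cvg g : aff_cvg U (fun=> g) g by split; exact: cvg_cst.
have [h vh] := value_cvg x AB.
pose m : R := `|score B h x| + 1 + (`|majorant K x B| + 1).
have yle : \forall t \near U, edist (y t) x ^+ 2 <= m.
  have v1 : \forall t \near U, value (A t) x < `|score B h x| + 1.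
    apply: (cvgr_lt _ vh); apply: le_lt_trans (ler_norm _) _.
    by rewrite ltrDl.
  have m1 : \forall t \near U, majorant K x (A t) < `|majorant K x B| + 1.
    apply: (cvgr_lt _ (cvg_majorant AB)); apply: le_lt_trans (ler_norm _) _.
    by rewrite ltrDl.
  apply: filterS3 v1 m1 (ymin x) => t v1 m1 yx.
  have := le_lt_trans (le_trans (score_le_value (A t) aff_id (y t)) yx) v1.
  rewrite /score aff_act_id aff_idE ltrBlDr => /lt_trans yt.
  by apply/ltW/yt; rewrite ltrD2l.
have [y0 yy0] : exists y0 : 'cV[R]_n, y t @[t --> U] --> y0.
  apply: (@ultra_bounded_cvg _ _ _ _ U _ _ (1 + m + enorm x)).
  apply: filterS yle => t yt i j; rewrite ord1.
  rewrite (le_trans (coord_le_enorm _ _))//.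
  rewrite -(subrK x (y t)) (le_trans (enormD _ _))// lerD2r -/(edist _ _).
  have := edist_ge0 (y t) x; nra.
exists y0; first exact: yy0.
move=> z; rewrite {1}/value; set g := best B y0.
have [h' vz] := value_cvg z AB.
apply: le_trans (score_le_value B h' z).
apply: cvg_le_near (cvg_score AB (const_cvg g) yy0) vz _.
by apply: filterS (ymin z) => t; apply: le_trans; exact: score_le_value.
Qed.

Lemma value_min A : exists y, forall z, value A y <= value A z.
Proof.
have [U [UU Umin]] := ultra_maximizing x (fun y => - value A y).
have [|y _ ymin] := minimizers_cvg (A := fun=> A) (y := id) (cvg_cst A).
  by move=> z; apply: filterS (Umin z) => t; rewrite lerN2.
by exists y.
Qed.

(** The supremum defining the value is attained, so strict convexity of the
    squared distance passes to it: at the midpoint of two distinct minimizers the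
    best map would score higher on one of the ends. *)
Lemma value_min_unique A y z :
  (forall w, value A y <= value A w) -> (forall w, value A z <= value A w) ->
  y = z.
Proof.
move=> ymin zmin; pose w := 2^-1 *: (y + z); set g := best A w.
have gw : g w = 2^-1 *: (g y + g z).
  rewrite /w /aff_fun -scalemxAr mulmxDr.
  move: (_ *m y) (_ *m z) => a b.
  by apply/colP => i; rewrite !mxE; field.
apply: (@aff_inj _ _ g); apply: edist_eq0.
have hy : score A g y <= score A g w := le_trans (score_le_value A g y) (ymin w).
have hz : score A g z <= score A g w := le_trans (score_le_value A g z) (zmin w).
have e2 : edist (g y) (g z) ^+ 2 <= 0.
  move: hy hz; rewrite /score gw edist_midpoint.
  move: (edist (g y) x ^+ 2) (edist (g z) x ^+ 2) (edist (g y) (g z) ^+ 2).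
  by move: (majorant _ _ _) => m a b e; lra.
by apply/eqP; rewrite -sqrf_eq0 eq_le e2 sqr_ge0.
Qed.

Definition center A : 'cV[R]_n := projT1 (cid (value_min A)).

Lemma center_min A y : value A (center A) <= value A y.
Proof. exact: (projT2 (cid (value_min A))). Qed.

Lemma center_unique A y : (forall z, value A y <= value A z) -> center A = y.
Proof.
by move=> ymin; apply: (value_min_unique _ ymin) => z; exact: center_min.
Qed.

Lemma center_act A g : center (aff_act g A) = g (center A).
Proof.
apply: center_unique => z; rewrite -(aff_invK g z) !value_act.
exact: center_min.
Qed.

Lemma center_continuous : continuous center.
Proof.
move=> A W AW; apply: (@ultra_ext _ (nbhs A)) => U UU AU.
have UA : B @[B --> U] --> A by exact: AU.
have [|y0 cy0 y0min] := minimizers_cvg (y := center) UA.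
  by move=> z; apply: filterE => B; exact: center_min.
by apply: cy0; rewrite -(center_unique y0min).
Qed.

(** At [x] no map scores above 0, because the penalty dominates the displacement;
    elsewhere the identity already scores at least 0. *)
Lemma centerK : center K = x.
Proof.
apply: center_unique => z; apply: (@le_trans _ _ 0).
  by rewrite subr_le0 displacement_le_majorant.
apply: le_trans (score_le_value K aff_id z).
by rewrite /score aff_act_id majorantKK// subr0 sqr_ge0.
Qed.

End affine_point.

Theorem theorem3p1 (R : realType) (n : nat) (hn : (1 <= n)%N)
    (K : convex_body R n) (x : 'cV[R]_n) (hx : affine_fixed_set K x) :
  exists p : convex_body R n -> 'cV[R]_n,
    affine_invariant_points p /\ p K = x.
Proof.
exists (center hn hx); split; last exact: centerK.
by split=> [|g A]; [exact: center_continuous|exact: center_act].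
Qed.
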